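(* Consider the group-harmonic maximization problem on a graph $G=(V,E,\ell)$ with budget $k$, and let $\lambda:=\ell_{\min}/\ell_{\max}$. The greedy algorithm (start with $S=\emptyset$; while $|S|<k$, add to $S$ a vertex $v\in V\setminus S$ maximizing $\mathrm{GH}(S\cup\{v\})-\mathrm{GH}(S)$; return $S$) returns a set $S$ with $|S|=k$ and $\mathrm{GH}(S)\ge \rho\cdot\max\{\mathrm{GH}(T): T\subseteq V, |T|=k\}$, where \begin{itemize} \item $\rho=\lambda(1-\frac{2}{e})>0.264\lambda$ if $G$ is directed; \item $\rho=\frac{\lambda}{2}(1-\frac{1}{e})>0.316\lambda$ if $G$ is undirected. \end{itemize}
   Context: $G=(V,E,\ell)$ is a weighted, possibly directed graph with $\ell:E\to\mathbb{N}_{>0}$ and no isolated nodes (not necessarily connected). $\ell_{\min}=\min_{e\in E}\ell(e)$, $\ell_{\max}=\max_{e\in E}\ell(e)$. $\mathrm{dist}(u,v)$ is the shortest-path length w.r.t. $\ell$, $\mathrm{dist}(S,v):=\min_{u\in S}\mathrm{dist}(u,v)$, and $\mathrm{GH}(S):=\sum_{v\in V\setminus S}\frac{1}{\mathrm{dist}(S,v)}$ with the term equal to $0$ if no path from $S$ to $v$ exists. Group-harmonic maximization: given $G$ and an integer $k$, find $S\subseteq V$ with $|S|=k$ maximizing $\mathrm{GH}(S)$. *)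

(* Defs.v *)
From mathcomp Require Import all_boot all_order all_algebra.
From mathcomp Require Import all_classical all_reals all_analysis.

Set Implicit Arguments.
Unset Strict Implicit.
Unset Printing Implicit Defensive.

Import Order.TTheory GRing.Theory Num.Theory.
Local Open Scope classical_set_scope.
Local Open Scope ring_scope.

(* [len G u v] is meaningful only when [edge G u v]. An undirected graph is one
   whose edges and lengths are symmetric, see [undirected]. Loops are allowed,
   but a loop does not prevent its vertex from being isolated. *)
Record wgraph (V : finType) := WGraph {
  edge : rel V;
  len : V -> V -> nat;
  len_gt0 : forall u v, edge u v -> (0 < len u v)%N;
  no_isolated : forall u, exists2 v, v != u & edge u v || edge v u
}.

Section GroupHarmonic.
Variables (R : realType) (V : finType) (G : wgraph V).

Definition undirected : Prop :=
  (forall u v, edge G u v = edge G v u) /\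
  (forall u v, edge G u v -> len G u v = len G v u).

Definition len_max : nat := \max_(a : V * V | edge G a.1 a.2) len G a.1 a.2.

(* The default value [len_max] only matters when there is no edge. *)
Definition len_min : nat :=
  \big[minn/len_max]_(a : V * V | edge G a.1 a.2) len G a.1 a.2.

Definition lambda : R := len_min%:R / len_max%:R.

Definition is_path (u v : V) (p : seq V) : Prop :=
  [/\ path (edge G) u p, uniq (u :: p) & last u p = v].

Definition path_len (u : V) (p : seq V) : nat := sumn (pairmap (len G) u p).

(* +oo when there is no path from u to v. *)
Definition dist (u v : V) : \bar R :=
  ereal_inf [set ((path_len u p)%:R)%:E | p in is_path u v].

(* +oo when S is empty. *)
Definition set_dist (S : {set V}) (v : V) : \bar R :=
  \big[mine/+oo%E]_(u in S) dist u v.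

Definition GH (S : {set V}) : R :=
  \sum_(v in ~: S) (if set_dist S v is r%:E then r^-1 else 0).

(* The states of the greedy while-loop; ties are broken arbitrarily. *)
Inductive greedy_state (k : nat) : {set V} -> Prop :=
| greedy_init : greedy_state k finset.set0
| greedy_step (S : {set V}) (v : V) :
    greedy_state k S -> (#|S| < k)%N -> v \notin S ->
    (forall w, w \notin S -> GH (w |: S) - GH S <= GH (v |: S) - GH S) ->
    greedy_state k (v |: S).

Definition greedy_returns (k : nat) (S : {set V}) : Prop :=
  greedy_state k S /\ ~~ (#|S| < k)%N.

(* GH is nonnegative, so the default value 0 does not affect the maximum. *)
Definition GH_opt (k : nat) : R :=
  \big[Num.max/0]_(T : {set V} | #|T| == k) GH T.

End GroupHarmonic.

Arguments lambda R {V} G.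
Arguments GH R {V} G S.
Arguments greedy_state R {V} G k S.
Arguments greedy_returns R {V} G k S.
Arguments GH_opt R {V} G k.

(* Main.v *)
Require Import Defs.
From mathcomp Require Import all_boot all_order all_algebra.
From mathcomp Require Import all_classical all_reals all_analysis.
From mathcomp Require Import fintype finset lra ring zify.
Import Order.TTheory GRing.Theory Num.Theory.
Local Open Scope ring_scope.

Set Implicit Arguments.
Unset Strict Implicit.
Unset Printing Implicit Defensive.

(* Normalise by [w u v = len_max / dist u v], so that an edge has weight at least
   1 and a two-edge path weight at least 1/2.  With h(v) the best weight from S
   to v, the value a(S) of S is the sum of h over the complement of S: a
   submodular but non-monotone function.  Truncating h at 1 costs the factor
   lambda, and it remains to compare a(S) with the truncated value t(T) of any T
   of size k.  Adding S to T costs t(T) at most |S|, so as long as the greedy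
   gains are nonnegative the usual argument gives
   a >= (1 - 1/e) t(T) - k/e after k steps.

   The subtracted term is controlled by a lower bound on a itself.  Summing the
   gains of all N vertices reached from S, where each reached vertex c may be
   improved by the last two vertices of a path from S to c, shows that if all
   gains are at most d, then (1 - d) N <= 2 a and (3/2 - d) N <= 3 a.  Along the
   greedy run N is at least n - i, where n counts the vertices with an
   in-neighbour and i = |S|; both recurrences can be solved.  The first gives
   a >= i (n - i) / n, hence a >= k/2 if 2k <= n, and the
   undirected bound if 2k > n.  The second gives a >= (3/11) n >= (1 - 2/e) n
   if 2k > n.  Once all gains are negative every vertex outside S is reached,
   and the first inequality with d = 0 gives a >= (|V| - k) / 2 from then on. *)

(** * Coverage functions *)

Section Coverage.
Variables (R : realFieldType) (V : finType) (w : V -> V -> R).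
Implicit Types (S T : {set V}) (u v x : V).

Definition cover_wt S v : R := \big[Num.max/0]_(u in S) w u v.

Definition cover_val S : R := \sum_(v in ~: S) cover_wt S v.

Definition gain S x : R := cover_val (x |: S) - cover_val S.

Lemma cover_wt_ge0 S v : 0 <= cover_wt S v.
Proof. exact: bigmax_ge_id. Qed.

Lemma le_cover_wt S u v : u \in S -> w u v <= cover_wt S v.
Proof. by move=> uS; apply: le_bigmax_cond. Qed.

Lemma cover_wt_le S v (b : R) :
  0 <= b -> (forall u, u \in S -> w u v <= b) -> cover_wt S v <= b.
Proof. by move=> b0 wb; apply: bigmax_le. Qed.

Lemma cover_wt_gt0 S v : 0 < cover_wt S v -> exists2 u, u \in S & 0 < w u v.
Proof.
move=> c0; have [/existsP[u /andP[uS wu]]|/existsPn no] :=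
  boolP [exists u, (u \in S) && (0 < w u v)]; first by exists u.
have /le_lt_trans/(_ c0) : cover_wt S v <= 0; last by rewrite ltxx.
apply: cover_wt_le => // u uS; have := no u.
by rewrite uS /= -leNgt.
Qed.

Lemma cover_wtU S T v :
  cover_wt (S :|: T) v = Num.max (cover_wt S v) (cover_wt T v).
Proof. exact: bigmaxU. Qed.

Lemma cover_wtS S T v : S \subset T -> cover_wt S v <= cover_wt T v.
Proof. by move=> /setUidPr <-; rewrite cover_wtU le_max lexx. Qed.

Lemma cover_wtU1 S x v :
  cover_wt (x |: S) v = Num.max (cover_wt S v) (Num.max (w x v) 0).
Proof.
by rewrite setUC cover_wtU /cover_wt (bigmax_set1 0 x (fun u => w u v)).
Qed.

Lemma cover_wt_subU1_ge0 S x v : 0 <= cover_wt (x |: S) v - cover_wt S v.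
Proof. by rewrite subr_ge0 cover_wtS // subsetUr. Qed.

Lemma cover_wt_subU1_ge S x v : w x v - cover_wt S v <= cover_wt (x |: S) v - cover_wt S v.
Proof. by rewrite lerD2r le_cover_wt // setU11. Qed.

Lemma cover_val_ge0 S : 0 <= cover_val S.
Proof. by apply: sumr_ge0 => v _; apply: cover_wt_ge0. Qed.

Lemma cover_val0 : cover_val set0 = 0.
Proof. by apply: big1 => v _; rewrite /cover_wt big_set0. Qed.

Lemma cover_val_split S x : x \notin S ->
  cover_val S = cover_wt S x + \sum_(v in ~: (x |: S)) cover_wt S v.
Proof.
move=> xS; rewrite /cover_val (big_setD1 x) ?inE //=; congr (_ + _).
by apply: eq_bigl => v; rewrite !inE negb_or.
Qed.

(** Adding [x] raises the weights of the vertices that stay outside but loses the weight of [x]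
    itself, which no longer counts. This loss makes [cover_val] non-monotone. *)
Lemma gainE S x : x \notin S -> gain S x =
  \sum_(v in ~: (x |: S)) (cover_wt (x |: S) v - cover_wt S v) - cover_wt S x.
Proof.
by move=> xS; rewrite /gain (cover_val_split xS) sumrB opprD addrAC -addrA.
Qed.

Lemma ler_sum_subset (A B : {set V}) (F : V -> R) : A \subset B ->
  (forall v, v \in B -> 0 <= F v) -> \sum_(v in A) F v <= \sum_(v in B) F v.
Proof.
move=> AB F0; rewrite [leRHS](big_setID A) /= (setIidPr AB) lerDl.
by apply: sumr_ge0 => v /setDP[vB _]; apply: F0.
Qed.

(** As the set grows, the maxima leave less room for improvement, fewer vertices lie outside, and
    the weight lost at [x] increases. *)
Lemma gain_antitone S T x : S \subset T -> x \notin T -> gain T x <= gain S x.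
Proof.
move=> ST xT; have xS : x \notin S by apply: contra xT; apply: (subsetP ST).
rewrite !gainE // lerB ?cover_wtS //.
apply: (@le_trans _ _
  (\sum_(v in ~: (x |: T)) (cover_wt (x |: S) v - cover_wt S v))).
  apply: ler_sum => v _; rewrite !cover_wtU1.
  have := cover_wtS v ST; set a := cover_wt S v; set b := cover_wt T v.
  set c := Num.max (w x v) 0 => ab.
  by rewrite /Num.max; case: (ltP b c); case: (ltP a c); lra.
apply: ler_sum_subset => [|v _]; last exact: cover_wt_subU1_ge0.
by rewrite setCS setUS.
Qed.

(** It is enough to bound each [w u v]: for [u] in [S] there is no increase, and otherwise the
    single term of [u] in the sum already covers it. *)
Lemma cover_wt_subU_le S T v : cover_wt (S :|: T) v - cover_wt S v <=
  \sum_(x in T :\: S) (cover_wt (x |: S) v - cover_wt S v).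
Proof.
set r := \sum_(x in _) _.
have r0 : 0 <= r by apply: sumr_ge0 => x _; apply: cover_wt_subU1_ge0.
rewrite lerBlDr; apply: cover_wt_le => [|u]; first by rewrite addr_ge0 ?cover_wt_ge0.
have [uS _|uS] := boolP (u \in S).
  by rewrite (le_trans (le_cover_wt v uS)) // lerDr.
rewrite inE (negPf uS) /= => uT; rewrite -lerBlDr (le_trans (cover_wt_subU1_ge _ _ _)) //.
rewrite /r (big_setD1 u) ?inE ?uS ?uT //= lerDl.
by apply: sumr_ge0 => x _; apply: cover_wt_subU1_ge0.
Qed.

Lemma sum_gain_ge S T :
  cover_val (S :|: T) - cover_val S <= \sum_(x in T :\: S) gain S x.
Proof.
have -> : cover_val S = \sum_(x in T :\: S) cover_wt S x +
                        \sum_(v in ~: (S :|: T)) cover_wt S v.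
  rewrite /cover_val (big_setID T) /=.
  by congr (_ + _); apply: eq_bigl => v; rewrite !inE ?negb_or andbC.
have -> : \sum_(x in T :\: S) gain S x =
  \sum_(x in T :\: S) \sum_(v in ~: (x |: S)) (cover_wt (x |: S) v - cover_wt S v)
  - \sum_(x in T :\: S) cover_wt S x.
  by rewrite -sumrB; apply: eq_bigr => x /setDP[_ xS]; rewrite gainE.
rewrite opprD addrCA [leLHS]addrC lerD2r -sumrB.
apply: (@le_trans _ _ (\sum_(x in T :\: S) \sum_(v in ~: (S :|: T))
   (cover_wt (x |: S) v - cover_wt S v))).
  by rewrite exchange_big /=; apply: ler_sum => v _; apply: cover_wt_subU_le.
apply: ler_sum => x /setDP[xT xS]; apply: ler_sum_subset => [|v _].
  by rewrite setCS setUC setUS // sub1set.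
exact: cover_wt_subU1_ge0.
Qed.

Definition trunc_val T : R := \sum_(v in ~: T) Num.min (cover_wt T v) 1.

Lemma trunc_val_ge0 T : 0 <= trunc_val T.
Proof. by apply: sumr_ge0 => v _; rewrite le_min cover_wt_ge0 ler01. Qed.

Lemma trunc_val_le_cover_valU S T :
  trunc_val T - #|S|%:R <= cover_val (S :|: T).
Proof.
rewrite lerBlDr /trunc_val (big_setID S) /= addrC lerD //.
  have -> : ~: T :\: S = ~: (S :|: T).
    by apply/setP => v; rewrite !inE negb_or.
  apply: ler_sum => v _; rewrite (le_trans _ (cover_wtS v (subsetUr S T))) //.
  by rewrite ge_min lexx.
apply: (@le_trans _ _ (\sum_(v in ~: T :&: S) 1)).
  by apply: ler_sum => v _; rewrite ge_min lexx orbT.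
by rewrite sumr_const ler_nat subset_leq_card // subsetIr.
Qed.

Lemma greedy_gain_ge S T (d : R) : 0 <= d ->
  (forall x, x \notin S -> gain S x <= d) ->
  trunc_val T - #|S|%:R - cover_val S <= #|T|%:R * d.
Proof.
move=> d0 gd; rewrite (le_trans (lerB (trunc_val_le_cover_valU S T) (lexx _))) //.
rewrite (le_trans (sum_gain_ge S T)) //.
(* Since [d] is nonnegative, the sum over [T :\: S] may be enlarged to [#|T|] copies of [d]. *)
apply: (@le_trans _ _ (\sum_(x in T :\: S) d)).
  by apply: ler_sum => x /setDP[_ /gd].
rewrite sumr_const -[leLHS]mulr_natl ler_wpM2r // ler_nat.
by rewrite subset_leq_card // subsetDl.
Qed.

End Coverage.
(** * Gains and reachability *)

Section Reach.
Variables (R : realFieldType) (V : finType) (w : V -> V -> R) (e : rel V).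
Hypothesis w_path : forall u p, path e u p -> uniq (u :: p) -> p != [::] ->
  (size p)%:R^-1 <= w u (last u p).
Hypothesis w_connect : forall u v, u != v -> 0 < w u v -> connect e u v.
Implicit Types (S T : {set V}) (c u v x : V).

Definition reached S := [set v in ~: S | 0 < cover_wt w S v].

(** Loops are discarded, because a loop does not make a vertex reachable from another one. *)
Definition targets := [set v | [exists u, (u != v) && e u v]].

Lemma connect_w_gt0 u v : u != v -> connect e u v -> 0 < w u v.
Proof.
move=> uv /connectP[p0 /shortenP[p pP pU _] vE].
have p0' : p != [::] by apply: contraNneq uv => pE; rewrite vE pE.
by rewrite vE (lt_le_trans _ (w_path pP pU p0')) // invr_gt0 ltr0n lt0n size_eq0.
Qed.

Lemma reachedP S v :
  reflect (v \notin S /\ exists2 u, u \in S & connect e u v) (v \in reached S).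
Proof.
apply: (iffP idP); rewrite !inE.
  move=> /andP[vS /cover_wt_gt0[u uS wu]]; split=> //; exists u => //.
  by apply: w_connect wu; apply: contraNneq vS => <-.
move=> [vS [u uS uv]]; rewrite vS (lt_le_trans _ (le_cover_wt w v uS)) //.
by rewrite connect_w_gt0 //; apply: contraNneq vS => <-.
Qed.

Lemma edge_target u v : u != v -> e u v -> v \in targets.
Proof. by move=> uv euv; rewrite inE; apply/existsP; exists u; rewrite uv. Qed.

Lemma reached_targets S : reached S \subset targets.
Proof.
apply/subsetP => v /reachedP[vS [u uS /connectP[p0 /shortenP[p pP pU _] vE]]].
move: pP pU vE; case/lastP: p => [|p x] pP pU vE; first by rewrite vE uS in vS.
rewrite last_rcons in vE; rewrite vE; move: pP; rewrite rcons_path => /andP[_].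
apply: edge_target; apply: contraTneq pU => lx.
by rewrite -rcons_cons rcons_uniq -lx mem_last.
Qed.

(* The witnesses are the last two vertices before [c] on a path from [S]. *)
Lemma reached_preds S c : c \in reached S -> cover_wt w S c < 1 ->
  exists x, [/\ x \in reached S, x != c, 1 <= w x c &
    cover_wt w S c < 2^-1 ->
    exists y, [/\ y \in reached S, y != c, y != x & 2^-1 <= w y c]].
Proof.
move=> /reachedP[cS [u uS /connectP[p0 /shortenP[p pP pU _] cE]]] lt1.
move: pP pU cE; case/lastP: p => [|p c'] pP pU cE; first by rewrite cE uS in cS.
rewrite last_rcons in cE; subst c'.
move: pP; rewrite rcons_path => /andP[pP xc].
have pU' := pU; rewrite -rcons_cons rcons_uniq in pU' => {pU}.
case/andP: pU' => cp pU.
set x := last u p in xc.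
have xNc : x != c by apply: contraNneq cp => <-; apply: mem_last.
have w1 : 1 <= w x c.
  by have := @w_path x [:: c]; rewrite /= xc inE xNc invr1; apply.
have xS : x \notin S.
  by apply: contraTN lt1 => xS; rewrite -leNgt (le_trans w1) // le_cover_wt.
have xR : x \in reached S.
  by apply/reachedP; split=> //; exists u => //; apply/connectP; exists p.
exists x; split=> // lt2.
move: (erefl x) pP pU cp; rewrite {1}/x.
case/lastP: p @x xc xNc w1 xS xR => [|p x'] x xc xNc w1 xS xR.
  (* An empty prefix would make [x] the starting vertex [u], which lies in [S]. *)
  by rewrite /x /= uS in xS.
rewrite /x last_rcons in xc xNc w1 xS xR * => _.
rewrite rcons_path => /andP[pP yx]; rewrite -rcons_cons rcons_uniq => /andP[xp pU].
rewrite mem_rcons inE negb_or => /andP[_ cp].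
set y := last u p in yx.
have yNc : y != c by apply: contraNneq cp => <-; apply: mem_last.
have yNx : y != x' by apply: contraNneq xp => <-; apply: mem_last.
have w2 : 2^-1 <= w y c.
  have := @w_path y [:: x'; c]; rewrite /= yx xc !inE negb_or yNc yNx xNc.
  exact.
have yS : y \notin S.
  by apply: contraTN lt2 => yS; rewrite -leNgt (le_trans w2) // le_cover_wt.
exists y; split=> //.
by apply/reachedP; split=> //; exists u => //; apply/connectP; exists p.
Qed.

(** All increments are nonnegative. The predecessor [x] of [c] alone gives [1 - h], and [y] adds
    [2^-1 - h] when [h < 2^-1]; for larger [h] the second bound follows from the first. *)
Lemma excess_ge S c : c \in reached S ->
  let h := cover_wt w S c in
  let E := \sum_(x in reached S :\ c) (cover_wt w (x |: S) c - h) in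
  1 - h <= E /\ 3 / 2 - 2 * h <= E.
Proof.
move=> cR h E.
have ge0 x : 0 <= cover_wt w (x |: S) c - h by apply: cover_wt_subU1_ge0.
have E0 : 0 <= E by apply: sumr_ge0 => x _; apply: ge0.
have [h1|h1] := leP 1 h; first by split; lra.
have [x [xR xc wx wy]] := reached_preds cR h1.
have xge : 1 - h <= cover_wt w (x |: S) c - h.
  by apply: le_trans (cover_wt_subU1_ge _ _ _ _); rewrite lerD2r.
have EE : E = cover_wt w (x |: S) c - h +
    \sum_(y in reached S :\ c :\ x) (cover_wt w (y |: S) c - h).
  by rewrite /E (big_setD1 x) // in_setD1 xc.
have E1 : 1 - h <= E by rewrite EE (le_trans xge) // lerDl sumr_ge0.
split=> //; have [h2|/wy [y [yR yc yx {}wy]]] := leP 2^-1 h; first lra.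
suff : 2^-1 - h <= \sum_(y in reached S :\ c :\ x) (cover_wt w (y |: S) c - h).
  by rewrite EE; lra.
have yge : 2^-1 - h <= cover_wt w (y |: S) c - h.
  by apply: le_trans (cover_wt_subU1_ge _ _ _ _); rewrite lerD2r.
rewrite (big_setD1 y) /=; last by rewrite !in_setD1 yx yc.
by rewrite (le_trans yge) // lerDl sumr_ge0.
Qed.

Lemma cover_val_reached S : cover_val w S = \sum_(v in reached S) cover_wt w S v.
Proof.
rewrite /cover_val (big_setID (reached S)) /= [X in _ + X]big1 ?addr0 => [|v].
  by apply: eq_bigl => v; rewrite !inE; case: (v \in S).
rewrite !inE => /andP[/[swap] ->] /=.
by rewrite lt_neqAle cover_wt_ge0 andbT negbK => /eqP.
Qed.

(* Summing the gains over [reached S] and exchanging the two sums, every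
   reached vertex contributes its excess. *)
Lemma cover_val_ge_card_reached S (d : R) :
  (forall x, x \in reached S -> gain w S x <= d) ->
  (1 - d) * #|reached S|%:R <= 2 * cover_val w S /\
  (3 / 2 - d) * #|reached S|%:R <= 3 * cover_val w S.
Proof.
move=> gd; set N := #|_|%:R; set a := cover_val w S.
pose E c := \sum_(x in reached S :\ c) (cover_wt w (x |: S) c - cover_wt w S c).
have EdN : \sum_(c in reached S) E c - a <= d * N.
  rewrite mulr_natr -sumr_const; apply: le_trans (ler_sum _ gd).
  rewrite /a cover_val_reached.
  have -> : \sum_(x in reached S) gain w S x = \sum_(x in reached S)
     \sum_(v in ~: (x |: S)) (cover_wt w (x |: S) v - cover_wt w S v) -
     \sum_(x in reached S) cover_wt w S x.
    rewrite -sumrB; apply: eq_bigr => x /reachedP[xS _].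
    by rewrite gainE.
  rewrite lerD2r /E.
  rewrite (exchange_big_dep (mem (reached S))) /=; last by move=> c x _ /setD1P[].
  apply: ler_sum => x xR.
  apply: (@le_trans _ _ (\sum_(v in reached S :\ x)
     (cover_wt w (x |: S) v - cover_wt w S v))).
    rewrite le_eqVlt; apply/orP; left; apply/eqP; apply: eq_bigl => v.
    by rewrite !in_setD1 xR andbT andbC eq_sym.
  apply: ler_sum_subset => [|v _]; last exact: cover_wt_subU1_ge0.
  by apply/subsetP => v; rewrite !inE negb_or; case/and3P=> -> ->.
have s1 : \sum_(c in reached S) (1 - cover_wt w S c) <= \sum_(c in reached S) E c.
  by apply: ler_sum => c /excess_ge[].
have s2 : \sum_(c in reached S) (3 / 2 - 2 * cover_wt w S c) <=
    \sum_(c in reached S) E c.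
  by apply: ler_sum => c /excess_ge[].
(* Both lower bounds on the sum of [E] meet the upper bound [d * N + a]; the weights in them sum to
   [a] and [2 * a], whence the factors 2 and 3. *)
move: s1 s2; rewrite !sumrB !sumr_const -mulr_sumr -cover_val_reached -/a.
by rewrite -[_ *+ _]mulr_natr -/N -[3 / 2 *+ _]mulr_natr -/N; split; lra.
Qed.

(** An in-neighbour [x] of [c] is neither in [S] nor reached, since otherwise [c] would be reached.
    Adding [x] thus loses nothing and raises the weight of [c] from 0 to at least 1. *)
Lemma unreached_gain S c : c \in targets -> c \notin S -> c \notin reached S ->
  exists2 x, x \notin S & 1 <= gain w S x.
Proof.
rewrite inE => /existsP[x /andP[xc exc]] cS cR.
have xS : x \notin S.
  by apply: contraNN cR => xS; apply/reachedP; split=> //; exists x => //; apply: connect1.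
have xR : x \notin reached S.
  apply: contraNN cR => /reachedP[_ [u uS ux]]; apply/reachedP; split=> //.
  by exists u => //; apply: connect_trans ux (connect1 exc).
have c0 v : v \notin S -> v \notin reached S -> cover_wt w S v = 0.
  rewrite !inE => -> /=; rewrite lt_neqAle cover_wt_ge0 andbT negbK.
  by move/eqP.
exists x => //; rewrite gainE // (c0 x) // subr0 (big_setD1 c) /=; last first.
  by rewrite !inE negb_or eq_sym xc.
rewrite -[leLHS]addr0 lerD //; last first.
  by apply: sumr_ge0 => v _; apply: cover_wt_subU1_ge0.
rewrite (c0 c) // subr0 (le_trans _ (le_cover_wt w c (setU11 x S))) //.
by have := @w_path x [:: c]; rewrite /= exc inE xc invr1; apply.
Qed.

Lemma unreached_self_gain S x : x \notin S -> x \notin reached S -> 0 <= gain w S x.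
Proof.
move=> xS xR; have : ~~ (0 < cover_wt w S x) by apply: contraNN xR; rewrite !inE xS.
rewrite -leNgt => c0; rewrite gainE // subr_ge0 (le_trans c0) //.
by apply: sumr_ge0 => v _; apply: cover_wt_subU1_ge0.
Qed.

Lemma reachedS S T v : S \subset T -> v \in reached S -> v \notin T -> v \in reached T.
Proof.
move=> ST; rewrite !inE => /andP[_ c0] ->.
exact: lt_le_trans c0 (cover_wtS w v ST).
Qed.

Lemma trunc_val_le_targets T : trunc_val w T <= #|targets :\: T|%:R.
Proof.
rewrite /trunc_val (big_setID targets) /= [X in _ + X]big1 ?addr0 => [|v].
  apply: (@le_trans _ _ (\sum_(v in ~: T :&: targets) 1)).
    by apply: ler_sum => v _; rewrite ge_min lexx orbT.
  by rewrite sumr_const ler_nat setIC -setDE.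
rewrite !inE => /andP[vt vT].
have : v \notin reached T.
  by apply: contraNN vt => /(subsetP (reached_targets _)); rewrite inE.
by rewrite !inE vT lt_neqAle cover_wt_ge0 andbT negbK => /eqP <-; rewrite min_l.
Qed.

End Reach.
(** * The greedy invariant *)

Section Recurrences.
Variable R : realFieldType.
Implicit Types (a d i n t z : R).

(** With [z = n - i], the gain satisfies [d >= 1 - 2 a / z], so [a + d >= 1 + a (z - 2) / z]; as
    [z >= 2], the lower bound on [a] can be inserted. *)
Lemma quadratic_bound_step n i a d : i + 2 <= n ->
  (n - i) * (1 - d) <= 2 * a -> i * (n - i) <= a * n -> 0 <= i ->
  (i + 1) * (n - (i + 1)) <= (a + d) * n.
Proof.
move=> zge; have [z zE] : exists z, z = n - i by exists (n - i).
have -> : n - (i + 1) = z - 1 by rewrite zE; lra.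
rewrite -zE; have -> : n = z + i by rewrite zE; lra.
have z2 : 2 <= z by lra.
move=> hd ha i0; rewrite -subr_ge0 -(pmulr_rge0 _ (_ : 0 < z)); last lra.
have h1 : 0 <= (2 * a - z * (1 - d)) * (z + i) by apply: mulr_ge0; lra.
have h2 : 0 <= (a * (z + i) - i * z) * (z - 2) by apply: mulr_ge0; lra.
lra.
Qed.

(** Here [a + d >= 3/2 + a (z - 3) / z], where [z] stands for [n - i]. The linear term solves this
    recurrence exactly; the cubic one leaves slack because [(z - 1)^3] exceeds [z^3 - 3 z^2] by
    [3 z - 1]. *)
Lemma cubic_bound_step n z a d : 3 <= z -> 3 <= n ->
  z * (3 / 2 - d) <= 3 * a ->
  3 / 4 * z * n ^+ 2 - 4 / 5 * z ^+ 3 <= a * n ^+ 2 ->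
  3 / 4 * (z - 1) * n ^+ 2 - 4 / 5 * (z - 1) ^+ 3 <= (a + d) * n ^+ 2.
Proof.
move=> z3 n3 hd ha; rewrite -subr_ge0 -(pmulr_rge0 _ (_ : 0 < z)); last lra.
have h1 : 0 <= (3 * a - z * (3 / 2 - d)) * n ^+ 2.
  by apply: mulr_ge0; [lra | rewrite exprn_ge0 //; lra].
have h2 : 0 <= (a * n ^+ 2 - (3 / 4 * z * n ^+ 2 - 4 / 5 * z ^+ 3)) * (z - 3).
  by apply: mulr_ge0; lra.
nra.
Qed.

(* Equality nearly holds at [z = 6 n / 7]. *)
Lemma cubic_le_linear n z : 0 <= z -> 0 < n ->
  3 / 4 * z * n ^+ 2 - 4 / 5 * z ^+ 3 <= (n - z) * n ^+ 2.
Proof.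
move=> z0 n0; rewrite -subr_ge0.
(* The least coefficient of [z ^+ 3] that keeps the difference nonnegative is 343/432, with double
   root [6 n / 7]; 4/5 lies slightly above it. *)
have -> : (n - z) * n ^+ 2 - (3 / 4 * z * n ^+ 2 - 4 / 5 * z ^+ 3) =
  343 / 432 * (z - 6 / 7 * n) ^+ 2 * (z + 12 / 7 * n) +
  (4 / 5 - 343 / 432) * z ^+ 3 by field.
apply: addr_ge0; apply: mulr_ge0; [|lra|lra|exact: exprn_ge0].
by apply: mulr_ge0; [lra|exact: sqr_ge0].
Qed.

(** As [d >= (t - i - a) / k] while [i] grows by 1, adding [k] to [t - a - i] yields a quantity that
    contracts by the factor [1 - 1 / k] at each step. *)
Lemma geometric_step (k t i a d q : R) : 0 < k ->
  t - i - a <= k * d -> t + k - a - i <= q * (t + k) -> 1 <= k ->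
  t + k - (a + d) - (i + 1) <= (1 - k^-1) * q * (t + k).
Proof.
move=> k0 hd ha k1; rewrite -mulrA.
have h : 0 <= 1 - k^-1 by rewrite subr_ge0 invf_le1.
apply: le_trans (ler_wpM2l h ha).
have -> : d = k * d * k^-1 by rewrite mulrAC divff ?mul1r // gt_eqF.
have : (t - i - a) * k^-1 <= k * d * k^-1 by rewrite ler_wpM2r // invr_ge0 ltW.
have : k * k^-1 = 1 by rewrite divff // gt_eqF.
set K := k^-1; set D := k * d; lra.
Qed.

End Recurrences.

Section GreedyInvariant.
Variables (R : realFieldType) (V : finType) (w : V -> V -> R) (e : rel V).
Hypothesis w_path : forall u p, path e u p -> uniq (u :: p) -> p != [::] ->
  (size p)%:R^-1 <= w u (last u p).
Hypothesis w_connect : forall u v, u != v -> 0 < w u v -> connect e u v.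
Variables (k : nat) (t : R).
Implicit Types (S T : {set V}) (c u v x : V) (j : nat).

Local Notation n := (#|targets e|).
Local Notation a S := (cover_val w S).
Local Notation reached := (reached w).

Definition stalled S :=
  ~: S = reached S /\ forall x, x \notin S -> gain w S x <= 0.

(** The bounds in [j] are kept for all [j <= #|S|]: [a] does not decrease in this phase, and the
    bound of an earlier step may be the stronger one. The first condition serves the case [n <= 3];
    the third takes over where an unreached target invalidates the recurrence of the cubic bound. *)
Definition progressing S := [/\
  (0 < #|S|)%N -> 1 <= a S,
  forall j, (j <= #|S|)%N -> (j <= n)%N ->
    j%:R * (n%:R - j%:R) <= a S * n%:R,
  ~~ (targets e :\: S \subset reached S) -> #|S|%:R <= a S,
  forall j, (j <= #|S|)%N -> (j + 2 <= n)%N ->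
    3 / 4 * (n%:R - j%:R) * n%:R ^+ 2 - 4 / 5 * (n%:R - j%:R) ^+ 3
      <= a S * n%:R ^+ 2 &
  t + k%:R - a S - #|S|%:R <= (1 - k%:R^-1) ^+ #|S| * (t + k%:R)].

Lemma stalled_setU1 S v : stalled S -> stalled (v |: S).
Proof.
move=> [SR Sg]; have sub : S \subset v |: S by apply: subsetUr.
split=> [|x xS]; last first.
  by rewrite (le_trans (gain_antitone _ sub xS)) // Sg // (contra _ xS) // => /(subsetP sub).
apply/setP => x; apply/idP/idP => [|]; rewrite [in X in X -> _]inE; last by case/andP.
move=> xS; apply: (reachedS sub) => //; rewrite -SR inE.
by apply: contra xS => /(subsetP sub).
Qed.

Lemma stalled_cover_val S : stalled S -> #|~: S|%:R <= 2 * a S.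
Proof.
move=> [SR Sg]; have [|+ _] := @cover_val_ge_card_reached _ _ w e w_path w_connect S 0.
  by move=> x; rewrite -SR inE; apply: Sg.
by rewrite subr0 mul1r -SR.
Qed.

Lemma progressing0 : (0 < n)%N -> 0 <= t -> progressing set0.
Proof.
move=> n0 t0; have n0' : 0 < n%:R :> R by rewrite ltr0n.
rewrite /progressing cover_val0 cards0; split=> //.
- by move=> j; rewrite leqn0 => /eqP->; rewrite !mul0r.
(* At [j = 0] the cubic bound is nonpositive, which is [cubic_le_linear] at [z = n]. *)
- move=> j; rewrite leqn0 => /eqP-> _; rewrite subr0 mul0r.
  by have := cubic_le_linear (ltW n0') n0'; rewrite subrr mul0r.
- by rewrite expr0 mul1r; lra.
Qed.

Lemma greedy_step_invariant S v (T : {set V}) : (0 < n)%N -> (0 < k)%N ->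
  #|T| = k -> trunc_val w T = t -> v \notin S ->
  (forall x, x \notin S -> gain w S x <= gain w S v) ->
  progressing S -> stalled (v |: S) \/ progressing (v |: S).
Proof.
move=> n_gt0 k_gt0 Tk Tt vS vmax [J4 J1 J5 J2 J3].
(* An unreached vertex outside [S] has nonnegative gain, so if the best gain is negative then [S]
   itself is already stalled. *)
have [d0|d0] := ltP (gain w S v) 0.
  left; apply: stalled_setU1; split=> [|x xS]; last exact: le_trans (vmax _ xS) (ltW d0).
  apply/setP => x; apply/idP/idP; last by rewrite !inE => /andP[].
  rewrite inE => xS; apply: contraTT d0 => xR; rewrite -leNgt.
  by rewrite (le_trans _ (vmax _ xS)) // unreached_self_gain.
right; have aE : a (v |: S) = a S + gain w S v by rewrite /gain addrC subrK.
have a0 : 0 <= a S := cover_val_ge0 w S.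
set d := gain w S v in d0 vmax aE *.
have cE : #|v |: S| = #|S|.+1 by rewrite cardsU1 vS.
have unr : ~~ (targets e :\: S \subset reached S) -> 1 <= d.
  move=> /subsetPn[c /setDP[ct cS] cR].
  by have [x xS gx] := unreached_gain w_path w_connect ct cS cR;
    apply: le_trans gx (vmax _ xS).
(* Replacing [N] by its lower bound needs [d <= b]; for larger [d] the left side is nonpositive
   anyway, as long as [#|S| < n]. *)
have bound_z b r N : 0 <= r -> 0 <= b -> n%:R - #|S|%:R <= N -> (b - d) * N <= r * a S ->
    (n%:R - #|S|%:R) * (b - d) <= r * a S \/ (n <= #|S|)%N.
  move=> r0 b0 zN q; have [|n_gt] := leqP n #|S|; [by right | left].
  have z0 : 0 <= n%:R - #|S|%:R :> R by rewrite subr_ge0 ler_nat ltnW.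
  have [bd|bd] := leP d b.
    by rewrite (le_trans _ q) // mulrC ler_wpM2l // subr_ge0.
  by rewrite (le_trans _ (mulr_ge0 r0 a0)) // mulr_ge0_le0 // subr_le0 ltW.
(* An unreached target forces [d >= 1], which settles the first inequality but not the second; the
   latter is claimed only when all targets outside [S] are reached. *)
have [p1 p2] : ((#|S| < n)%N -> (n%:R - #|S|%:R) * (1 - d) <= 2 * a S) /\
   ((#|S| < n)%N -> targets e :\: S \subset reached S ->
    (n%:R - #|S|%:R) * (3 / 2 - d) <= 3 * a S).
  have [sub|/unr d1] := boolP (targets e :\: S \subset reached S); last first.
    split=> // n_gt; rewrite (le_trans _ (mulr_ge0 (ler0n _ 2) a0)) //.
    by rewrite mulr_ge0_le0 ?subr_le0 // subr_ge0 ler_nat ltnW.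
  have Ncard : n%:R - #|S|%:R <= #|reached S|%:R :> R.
    rewrite lerBlDr -natrD ler_nat -(cardsID S (targets e)) addnC leq_add //.
      by rewrite subset_leq_card.
    by rewrite subset_leq_card // subsetIr.
  have [|q1 q2] := @cover_val_ge_card_reached _ _ w e w_path w_connect S d.
    by move=> x /(reachedP w_path w_connect)[xS _]; apply: vmax.
  have [p1|nS] := bound_z 1 2 _ (ler0n _ 2) ler01 Ncard q1; last by split; rewrite ltnNge nS.
  have h0 : 0 <= 3 / 2 :> R by lra.
  by have [p2|nS] := bound_z (3 / 2) 3 _ (ler0n _ 3) h0 Ncard q2;
    split=> //; rewrite ltnNge nS.
have Ss : (#|S|.+1)%:R = #|S|%:R + 1 :> R by rewrite -natr1.
rewrite /progressing aE cE Ss; split.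
- move=> _; have [/J4|] := ltnP 0 #|S|; first lra.
  rewrite leqn0 cards_eq0 => /eqP S0.
  suff : 1 <= d by lra.
  apply: unr; move: n_gt0; rewrite card_gt0 => /set0Pn[c ct].
  apply/subsetPn; exists c; first by rewrite S0 setD0.
  apply/negP => /(reachedP w_path w_connect)[_ [u]].
  by rewrite S0 inE.
- move=> j; rewrite leq_eqVlt => /predU1P[->|]; last first.
    rewrite ltnS => jS jn; apply: le_trans (J1 j jS jn) _.
    by rewrite ler_wpM2r ?ler0n //; lra.
  (* At [j = n] the bound is 0; otherwise [#|S| + 2 <= n], as the recurrence requires. *)
  rewrite leq_eqVlt => /predU1P[<-|lt_n].
    by rewrite subrr mulr0 mulr_ge0 ?ler0n //; lra.
  rewrite Ss; apply: quadratic_bound_step => //.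
  + by rewrite -natrD ler_nat addn2.
  + exact: p1 (ltnW lt_n).
  + by apply: J1 (ltnW (ltnW lt_n)).
- move=> un; suff nS : ~~ (targets e :\: S \subset reached S).
    by have := J5 nS; have := unr nS; lra.
  apply: contra un => sub; apply/subsetP => c /setDP[ct cS].
  apply: (reachedS (subsetUr [set v] S)) => //; apply: (subsetP sub).
  by rewrite inE ct andbT; apply: contra cS => cS; rewrite inE cS orbT.
- move=> j; rewrite leq_eqVlt => /predU1P[->|]; last first.
    rewrite ltnS => jS jn; apply: le_trans (J2 j jS jn) _.
    by rewrite ler_wpM2r ?exprn_ge0 ?ler0n //; lra.
  rewrite Ss addn2 => jn.
  have n3 : 3 <= n%:R :> R by rewrite (ler_nat _ 3) (leq_trans _ jn).
  have z3 : 3 <= n%:R - #|S|%:R :> R by rewrite lerBrDr -natrD ler_nat.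
  have [sub|nS] := boolP (targets e :\: S \subset reached S).
    have -> : n%:R - (#|S|%:R + 1) = n%:R - #|S|%:R - 1 :> R by lra.
    apply: cubic_bound_step => //; first exact: p2 (ltnW (ltnW jn)) sub.
    by apply: J2; rewrite // addn2 ltnW.
  (* With an unreached target, [a + d >= #|S| + 1], and this linear bound dominates the cubic
     one. *)
  have z0 : 0 <= n%:R - (#|S|%:R + 1) :> R by lra.
  have n0 : 0 < n%:R :> R by lra.
  apply: le_trans (cubic_le_linear z0 n0) _; rewrite ler_wpM2r ?exprn_ge0 ?ler0n //.
  by have := J5 nS; have := unr nS; lra.
- rewrite exprS; apply: geometric_step => //.
  + by rewrite ltr0n.
  + by rewrite -Tt -Tk; apply: greedy_gain_ge.
  + by rewrite (ler_nat _ 1).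
Qed.
End GreedyInvariant.
(** * Bounds on e *)

Section Exponential.
Variable R : realType.

Lemma series_exp_coeff1 (m : nat) :
  series (@exp_coeff R 1) m = \sum_(0 <= i < m) i`!%:R^-1.
Proof. by apply: eq_bigr => i _; rewrite /exp_coeff /= expr1n mul1r. Qed.

(** The seven terms up to [1 / 6!] sum to 1957/720, just above 2.718. The precision is needed
    because the numerical claims require [e > 250 / 92], about 2.7174. *)
Lemma expR1_gt : 1359 / 500 < expR 1 :> R.
Proof.
have nd : {homo series (@exp_coeff R 1) : m n / (m <= n)%N >-> m <= n}.
  by apply/nondecreasing_seqP => n; rewrite seriesSr lerDl exp_coeff_ge0.
have := @nondecreasing_cvgn_le R _ nd (is_cvg_series_exp_coeff 1) 7.
rewrite -/(expR 1); apply: lt_le_trans.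
rewrite series_exp_coeff1 !big_nat_recr //= big_geq //.
have [-> -> ->] : [/\ 0`! = 1, 1`! = 1 & 2`! = 2]%N by [].
have [-> -> -> ->] : [/\ 3`! = 6, 4`! = 24, 5`! = 120 & 6`! = 720]%N by [].
lra.
Qed.

(* The partial sums satisfy s_m + 2/m! <= s_4 + 2/4! = 11/4 for m >= 4. *)
Lemma expR1_le : expR 1 <= 11 / 4 :> R.
Proof.
have bnd m : series (@exp_coeff R 1) (m + 4)%N + 2 / (m + 4)`!%:R <= 11 / 4.
  elim: m => [|m IH].
    rewrite series_exp_coeff1 !big_nat_recr //= big_geq //.
    have [-> -> -> -> ->] :
      [/\ 0`! = 1, 1`! = 1, 2`! = 2, 3`! = 6 & (0 + 4)`! = 24]%N by [].
    lra.
  apply: le_trans IH; rewrite addSn seriesSr -addrA lerD2l /exp_coeff /= expr1n.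
  rewrite factS natrM invfM; set F := _`!%:R^-1.
  have F0 : 0 <= F by rewrite invr_ge0 ler0n.
  have : (m + 4).+1%:R^-1 <= 2^-1 :> R by rewrite lef_pV2 ?posrE ?ltr0n // ler_nat; lia.
  by rewrite div1r -/F => /(ler_wpM2r F0); set X := _^-1 * F; lra.
apply: limr_le; first exact: is_cvg_series_exp_coeff.
exists 4%N => // m /= m4; rewrite -(subnK m4).
by apply: le_trans (bnd (m - 4)%N); rewrite lerDl divr_ge0 ?ler0n.
Qed.

Lemma pow_1subV_le (k : nat) : (0 < k)%N -> (1 - k%:R^-1) ^+ k <= (expR 1)^-1 :> R.
Proof.
move=> k0; have k0' : k%:R != 0 :> R by rewrite pnatr_eq0 -lt0n.
have -> : (expR 1)^-1 = expR (- k%:R^-1) ^+ k :> R.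
  by rewrite -expRM_natr mulNr mulVf // expRN.
apply: lerXn2r; rewrite ?nnegrE ?expR_ge0 ?subr_ge0 ?invf_le1 ?ltr0n ?(ler_nat _ 1) //.
exact: expR_ge1Dx.
Qed.

(** The upper bound is 0.368, for which [1 - 2 * 0.368 = 0.264] and [(1 - 0.368) / 2 = 0.316]; the
    lower bound gives [1 - 2 / e <= 3 / 11]. *)
Lemma invr_expR1_bounds : 4 / 11 <= (expR (1 : R))^-1 < 92 / 250.
Proof.
have e0 := expR_gt0 (1 : R); apply/andP; split.
  by rewrite -[4 / 11]invf_div lef_pV2 ?posrE ?expR1_le //; lra.
have p0 : 0 < 250 / 92 :> R by lra.
rewrite -[92 / 250]invf_div ltf_pV2 ?posrE //.
by have := expR1_gt; lra.
Qed.

End Exponential.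
(** * Harmonic weights of a graph *)

Section HarmonicWeight.
Variables (R : realType) (V : finType) (G : wgraph V).
Hypothesis V_nonempty : (0 < #|V|)%N.
Implicit Types (S T : {set V}) (u v : V) (p : seq V).

Local Notation lmax := (len_max G).
Local Notation lmin := (len_min G).

Lemma len_le_max u v : edge G u v -> (len G u v <= lmax)%N.
Proof. exact: (@leq_bigmax_cond _ _ (fun a : V * V => len G a.1 a.2) (u, v)). Qed.

Lemma len_ge_min u v : edge G u v -> (lmin <= len G u v)%N.
Proof.
rewrite /len_min => euv; have := mem_index_enum (u, v).
elim: (index_enum _) => // a r IH; rewrite inE big_cons => /predU1P[<-|/IH le_r].
  by rewrite euv geq_minl.
by case: ifP => // _; rewrite geq_min le_r orbT.
Qed.

Lemma len_max_gt0 : (0 < lmax)%N.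
Proof.
have /card_gt0P[u _] := V_nonempty; have [v _ /orP[] euv] := no_isolated G u.
  exact: leq_trans (len_gt0 euv) (len_le_max euv).
exact: leq_trans (len_gt0 euv) (len_le_max euv).
Qed.

Lemma len_min_gt0 : (0 < lmin)%N.
Proof.
apply: (big_ind (fun m => (0 < m)%N)) => [|x y x0 y0|a]; first exact: len_max_gt0.
  by rewrite leq_min x0.
exact: len_gt0.
Qed.

Lemma path_len_le u p : path (edge G) u p -> (path_len G u p <= lmax * size p)%N.
Proof.
elim: p u => [|v p IH] u //= /andP[euv pP]; rewrite /path_len /= mulnS.
by rewrite leq_add ?len_le_max // IH.
Qed.

Lemma path_len_ge u p : path (edge G) u p -> p != [::] -> (lmin <= path_len G u p)%N.
Proof.
case: p => // v p /andP[euv _] _.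
by rewrite /path_len /= (leq_trans (len_ge_min euv)) // leq_addr.
Qed.

Lemma dist_le_path u p : path (edge G) u p -> uniq (u :: p) ->
  (dist R G u (last u p) <= ((path_len G u p)%:R)%:E)%E.
Proof. by move=> pP pU; apply: ereal_inf_lbound; exists p. Qed.

Lemma dist_ge_min u v : u != v -> (lmin%:R%:E <= dist R G u v)%E.
Proof.
move=> uv; apply: le_ereal_inf_tmp => _ [p [pP _ pv] <-].
rewrite lee_fin ler_nat path_len_ge //.
by apply: contraNneq uv => pE; rewrite -pv pE.
Qed.

(** This relation turns minima of distances into maxima of weights and matches [+oo] with 0, the
    starting values of the two iterated operations; it therefore passes from single vertices to
    sets. *)
Variant recip_spec (x : \bar R) (y : R) : Prop :=
| Recip_oo of x = +oo%E & y = 0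
| Recip_fin r of x = r%:E & 0 < r & y = lmax%:R / r.

Definition harmonic_wt u v : R :=
  if dist R G u v is r%:E then lmax%:R / r else 0.

Lemma harmonic_wtP u v : u != v -> recip_spec (dist R G u v) (harmonic_wt u v).
Proof.
move=> uv; have := dist_ge_min uv; rewrite /harmonic_wt.
case E: (dist R G u v) => [r| |] // hr; last by left.
right with r => //; rewrite lee_fin in hr; apply: lt_le_trans hr.
by rewrite ltr0n len_min_gt0.
Qed.

Lemma recip_spec_min (x1 x2 : \bar R) (y1 y2 : R) :
  recip_spec x1 y1 -> recip_spec x2 y2 ->
  recip_spec (mine x1 x2) (Num.max y1 y2).
Proof.
have M0 : 0 < lmax%:R :> R by rewrite ltr0n len_max_gt0.
have pos r : 0 < r -> 0 <= lmax%:R / r by move=> r0; rewrite divr_ge0 ?ler0n // ltW.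
move=> [-> ->|r1 -> r1p ->] [-> ->|r2 -> r2p ->].
- by left; rewrite ?maxxx // minxx.
- by right with r2 => //; rewrite ?minye // max_r ?pos.
- by right with r1 => //; rewrite ?miney // max_l ?pos.
- have [le12|/ltW le21] := leP r1 r2.
    right with r1 => //; first by rewrite min_l // lee_fin.
    by rewrite max_l // ler_pM2l // lef_pV2.
  right with r2 => //; first by rewrite min_r // lee_fin.
  by rewrite max_r // ler_pM2l // lef_pV2.
Qed.

Lemma set_distP S v : v \notin S ->
  recip_spec (set_dist R G S v) (cover_wt harmonic_wt S v).
Proof.
move=> vS; apply: (big_ind2 recip_spec).
- by left.
- by move=> x1 y1 x2 y2; apply: recip_spec_min.
- by move=> u uS; apply: harmonic_wtP; apply: contraNneq vS => <-.
Qed.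

Lemma cover_val_harmonic S : cover_val harmonic_wt S = lmax%:R * GH R G S.
Proof.
rewrite /cover_val /GH mulr_sumr; apply: eq_bigr => v; rewrite inE => vS.
by case: (set_distP vS) => [-> ->|r -> _ ->]; rewrite ?mulr0.
Qed.

Lemma gain_harmonic S x : gain harmonic_wt S x =
  lmax%:R * (GH R G (x |: S) - GH R G S).
Proof. by rewrite /gain !cover_val_harmonic mulrBr. Qed.

Lemma harmonic_wt_path u p : path (edge G) u p -> uniq (u :: p) -> p != [::] ->
  (size p)%:R^-1 <= harmonic_wt u (last u p).
Proof.
move=> pP pU p0; have M0 : 0 < lmax%:R :> R by rewrite ltr0n len_max_gt0.
have uv : u != last u p.
  case: p p0 pP pU => // x p _ _ /= /andP[uN _].
  by apply: contraNneq uN => ->; apply: mem_last.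
have s0 : 0 < (size p)%:R :> R by rewrite ltr0n lt0n size_eq0.
have := dist_le_path pP pU; case: (harmonic_wtP uv) => [-> _|r -> r0 ->].
  by rewrite leye_eq.
rewrite lee_fin => rle; rewrite ler_pdivlMr // ler_pdivrMl //.
by rewrite (le_trans rle) // -natrM ler_nat mulnC path_len_le.
Qed.

Lemma harmonic_wt_connect u v : u != v -> 0 < harmonic_wt u v -> connect (edge G) u v.
Proof.
move=> uv w0; have [[p [pP _ pv]]|no] := pselect (exists p, is_path G u v p).
  by apply/connectP; exists p.
suff : dist R G u v = +oo%E by move: w0; rewrite /harmonic_wt => /[swap] ->; rewrite ltxx.
by apply/ereal_inf_pinfty => x [p pP _]; case: no; exists p.
Qed.

Lemma harmonic_wt_le u v : u != v -> harmonic_wt u v <= lmax%:R / lmin%:R.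
Proof.
move=> uv; have m0 : 0 < lmin%:R :> R by rewrite ltr0n len_min_gt0.
have := dist_ge_min uv; case: (harmonic_wtP uv) => [_ ->|r -> r0 ->].
  by rewrite divr_ge0 ?ler0n.
by rewrite lee_fin => mr; rewrite ler_wpM2l ?ler0n // lef_pV2.
Qed.

Lemma lambda_gt0 : 0 < lambda R G.
Proof. by rewrite divr_gt0 ?ltr0n ?len_min_gt0 ?len_max_gt0. Qed.

Lemma lambda_le1 : lambda R G <= 1.
Proof.
rewrite ler_pdivrMr ?ltr0n ?len_max_gt0 // mul1r ler_nat.
have /card_gt0P[u _] := V_nonempty; have [v _ /orP[] euv] := no_isolated G u.
  exact: leq_trans (len_ge_min euv) (len_le_max euv).
exact: leq_trans (len_ge_min euv) (len_le_max euv).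
Qed.

(** Distinct vertices are at distance at least [len_min], so every weight is at most the inverse of
    [lambda]; scaling by [lambda <= 1] brings it below both 1 and itself. *)
Lemma lambda_cover_val_le T :
  lambda R G * cover_val harmonic_wt T <= trunc_val harmonic_wt T.
Proof.
have m0 : 0 < lmin%:R :> R by rewrite ltr0n len_min_gt0.
have M0 : 0 < lmax%:R :> R by rewrite ltr0n len_max_gt0.
rewrite mulr_sumr; apply: ler_sum => v; rewrite inE => vT; rewrite le_min.
rewrite ler_piMl ?cover_wt_ge0 ?lambda_le1 //= /lambda.
apply: (@le_trans _ _ (lmin%:R / lmax%:R * (lmax%:R / lmin%:R))).
  rewrite ler_wpM2l ?divr_ge0 ?ler0n // cover_wt_le ?divr_ge0 ?ler0n // => u uT.
  by apply: harmonic_wt_le; apply: contraNneq vT => <-.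
by rewrite mulrA divfK ?divff // gt_eqF.
Qed.

End HarmonicWeight.
(** * The approximation ratio *)

Section ProgressBounds.
Variables (R : realType) (V : finType) (w : V -> V -> R) (e : rel V).
Variables (t : R) (S : {set V}).
Hypothesis S_prog : progressing w e #|S| t S.
Hypothesis S_gt0 : (0 < #|S|)%N.

Local Notation n := (#|targets e|).

(** The quadratic bound at [j = #|S|] gives [#|S| <= 2 a]. The geometric bound then implies
    [t - a <= (t + 2 a) / e], and [1 + 2 / e <= 2] concludes. *)
Lemma progressing_half : 0 <= t -> (#|S|.*2 <= n)%N ->
  2^-1 * (1 - (expR 1)^-1) * t <= cover_val w S.
Proof.
case: S_prog => _ J1 _ _ J3 t_ge0 k2.
have a0 := cover_val_ge0 w S; set a := cover_val w S in J1 J3 a0 *.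
have kn : (#|S| <= n)%N by apply: leq_trans k2; rewrite -addnn leq_addr.
have n0 : 0 < n%:R :> R by rewrite ltr0n (leq_trans S_gt0).
have ka : #|S|%:R <= 2 * a.
  have := J1 _ (leqnn _) kn.
  have : 2 * #|S|%:R <= n%:R :> R by rewrite -natrM ler_nat mul2n.
  have : 0 <= #|S|%:R :> R by [].
  set k := #|S|%:R; set m := n%:R in n0 * => k0 km h.
  rewrite -(ler_pM2r n0); nra.
have := pow_1subV_le R S_gt0; set q := _ ^+ _ in J3 *.
have /andP[+ +] := invr_expR1_bounds R; set E := (expR 1)^-1 => E1 E2 qE.
have : q * (t + #|S|%:R) <= E * (t + 2 * a).
  apply: (@le_trans _ _ (E * (t + #|S|%:R))).
    by rewrite ler_wpM2r // addr_ge0.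
  by rewrite ler_wpM2l ?lerD2l //; lra.
move: J3; set k := #|S|%:R; nra.
Qed.

(** The quadratic bound is taken at the earlier step [j = n - #|S|], where it reads
    [(n - #|S|) * #|S| <= a * n]. *)
Lemma progressing_ge_compl : (n < #|S|.*2)%N -> (#|S| <= n)%N ->
  n%:R - #|S|%:R <= 2 * cover_val w S.
Proof.
case: S_prog => _ J1 _ _ _ k2 kn.
set a := cover_val w S in J1 *.
have n0 : 0 < n%:R :> R by rewrite ltr0n (leq_trans S_gt0).
have jS : (n - #|S| <= #|S|)%N by rewrite leq_subLR addnn ltnW.
have := J1 _ jS (leq_subr _ _); rewrite natrB //.
have : n%:R <= 2 * #|S|%:R :> R by rewrite -natrM ler_nat mul2n ltnW.
have : #|S|%:R <= n%:R :> R by rewrite ler_nat.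
set k := #|S|%:R; set m := n%:R in n0 * => km mk h.
rewrite -(ler_pM2r n0); nra.
Qed.

Lemma progressing_ge_targets : (n < #|S|.*2)%N -> 3 / 11 * n%:R <= cover_val w S.
Proof.
case: S_prog => J4 _ _ J2 _ k2.
(* For [n <= 3] the bound [a >= 1] suffices, as 9/11 is below 1; from 4 on, the cubic bound is
   available at [n./2]. *)
have [n3|n4] := leqP n 3.
  have : n%:R <= 3 :> R by rewrite (ler_nat _ _ 3).
  by have := J4 S_gt0; lra.
have jS : (n./2 <= #|S|)%N by rewrite -[#|S|]doubleK half_leq // ltnW.
have jn : (n./2 + 2 <= n)%N.
  by move: n4; move: n => m; lia.
(* Here [n - n./2] is [n / 2] rounded up, hence between [n / 2] and [3 n / 5], the upper end being
   attained at [n = 5]. *)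
have := J2 _ jS jn; set a := cover_val w S.
have hz1 : n%:R <= 2 * (n%:R - n./2%:R) :> R.
  suff : n./2%:R * 2 <= n%:R :> R by lra.
  by rewrite -natrM ler_nat; lia.
have hz2 : 5 * (n%:R - n./2%:R) <= 3 * n%:R :> R.
  suff : 2 * n%:R <= 5 * n./2%:R :> R by lra.
  by rewrite -!natrM ler_nat; move: n4; move: n => m; lia.
have n0 : 0 < n%:R :> R by rewrite ltr0n (leq_trans _ n4).
set z := _ - _ in hz1 hz2 *; set m := n%:R in n0 hz1 hz2 * => h.
have n20 : 0 < m ^+ 2 by rewrite exprn_gt0.
rewrite -(ler_pM2r n20); apply: le_trans h; rewrite -subr_ge0.
(* At [z = m / 2] the difference is [(11/40 - 3/11) m^3 = m^3 / 440]; the quadratic cofactor of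
   [z - m / 2] is nonnegative up to [z = 3 m / 5]. *)
have -> : 3 / 4 * z * m ^+ 2 - 4 / 5 * z ^+ 3 - 3 / 11 * m * m ^+ 2 =
  (z - m / 2) * (11 / 20 * m ^+ 2 - 2 / 5 * z * m - 4 / 5 * z ^+ 2) +
  1 / 440 * (m * m ^+ 2) by field.
apply: addr_ge0; last by apply: mulr_ge0; [lra | rewrite mulr_ge0 // ltW].
apply: mulr_ge0; first lra.
have : 0 <= (3 * m - 5 * z) * z by apply: mulr_ge0; lra.
have : 0 <= (3 * m - 5 * z) * m by apply: mulr_ge0; lra.
nra.
Qed.

End ProgressBounds.

Section Greedy.
Variables (R : realType) (V : finType) (G : wgraph V) (k : nat).
Hypothesis V_nonempty : (0 < #|V|)%N.
Implicit Types (S T : {set V}).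

Local Notation w := (harmonic_wt R G).
Local Notation e := (edge G).

Lemma targets_gt0 : (0 < #|targets e|)%N.
Proof.
have /card_gt0P[u _] := V_nonempty; have [v vu /orP[] euv] := no_isolated G u;
  apply/card_gt0P.
  by exists v; apply: (edge_target _ euv); rewrite eq_sym.
by exists u; apply: (edge_target vu euv).
Qed.

Lemma targets_undirected : undirected G -> targets e = setT.
Proof.
move=> [esym _]; apply/setP => u; rewrite in_setT.
have [v vu euv] := no_isolated G u; apply: (edge_target vu).
by move: euv; rewrite esym orbb.
Qed.

Lemma greedy_card_le S : greedy_state R G k S -> (#|S| <= k)%N.
Proof. by elim=> [|S' v _ _ lt_k vS _]; rewrite ?cards0 // cardsU1 vS. Qed.

Lemma greedy_exists : (k <= #|V|)%N -> exists S, greedy_returns R G k S.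
Proof.
move=> kV; suff H i : (i <= k)%N -> exists2 S, greedy_state R G k S & #|S| = i.
  by have [S gS Sk] := H k (leqnn _); exists S; split=> //; rewrite Sk ltnn.
elim: i => [_|i IH ik]; first by exists set0; [left | rewrite cards0].
have [S gS Si] := IH (ltnW ik).
have /card_gt0P[v0 v0S] : (0 < #|~: S|)%N.
  by rewrite cardsCs setCK subn_gt0 Si (leq_trans ik).
pose v := [arg max_(v > v0 in ~: S) (GH R G (v |: S) - GH R G S)]%O.
have [vS vmax] : v \notin S /\ forall x, x \notin S ->
    GH R G (x |: S) - GH R G S <= GH R G (v |: S) - GH R G S.
  rewrite /v; case: arg_maxP => // x; rewrite inE => xS xmax.
  by split=> // y yS; apply: xmax; rewrite inE.
exists (v |: S); last by rewrite cardsU1 vS Si.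
by right => //; rewrite Si.
Qed.

Lemma greedy_invariant S T : (0 < k)%N -> #|T| = k -> greedy_state R G k S ->
  stalled w S \/ progressing w e k (trunc_val w T) S.
Proof.
move=> k0 Tk; have wp := @harmonic_wt_path R V G V_nonempty.
have wc := @harmonic_wt_connect R V G.
elim=> [|S' v _ [st|pr] _ vS vmax].
- by right; apply: progressing0; [exact: targets_gt0 | exact: trunc_val_ge0].
- by left; apply: stalled_setU1.
- apply: (greedy_step_invariant wp wc targets_gt0 k0 Tk) => // x xS.
  by rewrite !gain_harmonic // ler_wpM2l ?ler0n // vmax.
Qed.

Lemma greedy_trunc_bound S T : #|T| = k -> greedy_returns R G k S ->
  (1 - 2 / expR 1) * trunc_val w T <= cover_val w S /\
  (undirected G -> 2^-1 * (1 - 1 / expR 1) * trunc_val w T <= cover_val w S).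
Proof.
move=> Tk [gS Sge]; have Sk : #|S| = k.
  by apply/eqP; rewrite eqn_leq greedy_card_le // leqNgt.
have a0 := cover_val_ge0 w S; have t0 := trunc_val_ge0 w T.
have wp := @harmonic_wt_path R V G V_nonempty.
have wc := @harmonic_wt_connect R V G.
have tle := trunc_val_le_targets wp wc T.
have tn : trunc_val w T <= #|targets e|%:R.
  by rewrite (le_trans tle) // ler_nat subset_leq_card // subsetDl.
have tnk : trunc_val w T <= #|~: S|%:R.
  have -> : #|~: S| = #|~: T| by rewrite [LHS]cardsCs [RHS]cardsCs !setCK Sk Tk.
  by rewrite (le_trans tle) // ler_nat subset_leq_card // setDE subsetIr.
have /andP[] := invr_expR1_bounds R; rewrite div1r.
set E := (expR 1)^-1; set a := cover_val w S in a0 *.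
set t := trunc_val w T in t0 tn tnk * => E1 E2.
(* Both ratios are at most 1/2. *)
have half : t <= 2 * a -> (1 - 2 * E) * t <= a /\
    (undirected G -> 2^-1 * (1 - E) * t <= a) by move=> ta; split=> [|_]; nra.
have [k0|] := posnP k.
  apply: half; suff -> : t = 0 by rewrite mulr_ge0.
  move: Tk; rewrite k0 => /cards0_eq T0; rewrite /t T0; apply: big1 => v _.
  by rewrite /cover_wt big_set0 min_l.
move=> k0; have [/(stalled_cover_val wp wc) st|pr] := greedy_invariant k0 Tk gS.
  by apply: half; apply: le_trans st.
rewrite -Sk -/t in pr k0; have [k2|k2] := leqP #|S|.*2 #|targets e|.
  have h := progressing_half pr k0 t0 k2; rewrite -/E -/a in h.
  (* The directed ratio is the smaller one: [1 - 2 E <= (1 - E) / 2] because [E >= 1 / 3]. *)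
  by split=> //; nra.
split=> [|und].
  by have := progressing_ge_targets pr k0 k2; rewrite -/a; nra.
(* In an undirected graph every vertex is a target, so [n - k] is the size of the complement of [S],
   which bounds [t]. *)
have kn : (#|S| <= #|targets e|)%N by rewrite targets_undirected // cardsT max_card.
have := progressing_ge_compl pr k0 k2 kn; rewrite -/a -natrB // targets_undirected // cardsT.
rewrite cardsCs setCK in tnk; by move=> /(le_trans tnk)/half[_]; apply.
Qed.

(** Since [cover_val] is [len_max] times [GH], the comparison with [trunc_val] rescales to [GH], the
    factor [lambda] being the price of truncation. The default 0 of the maximum is covered by the
    nonnegativity of [GH]. *)
Lemma GH_opt_le S (c : R) : 0 < c ->
  (forall T, #|T| = k ->
    c * trunc_val w T <= cover_val w S) ->
  lambda R G * c * GH_opt R G k <= GH R G S.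
Proof.
move=> c0 bnd; have M0 : 0 < (len_max G)%:R :> R by rewrite ltr0n len_max_gt0.
have l0 := lambda_gt0 R G V_nonempty.
have lc0 := mulr_gt0 l0 c0; rewrite -ler_pdivlMl // /GH_opt; apply: bigmax_le => [|T /eqP Tk].
  rewrite mulr_ge0 ?invr_ge0 ?(ltW lc0) //.
  by rewrite -(pmulr_rge0 _ M0) -cover_val_harmonic // cover_val_ge0.
rewrite ler_pdivlMl // -(ler_pM2l M0) -cover_val_harmonic //.
apply: le_trans (bnd T Tk).
rewrite mulrCA mulrC -cover_val_harmonic // mulrC [_ * c]mulrC -mulrA.
by rewrite ler_wpM2l ?(ltW c0) // lambda_cover_val_le.
Qed.

End Greedy.

Theorem theorem3p2 (R : realType) (V : finType) (G : wgraph V) (k : nat)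
    (V_nonempty : (0 < #|V|)%N) (k_le : (k <= #|V|)%N) :
  (exists S : {set V}, greedy_returns R G k S) /\
  (forall S : {set V}, greedy_returns R G k S ->
    [/\ #|S| = k,
        GH R G S >= lambda R G * (1 - 2 / expR 1) * GH_opt R G k
      & undirected G ->
        GH R G S >= lambda R G / 2 * (1 - 1 / expR 1) * GH_opt R G k]) /\
  lambda R G * (1 - 2 / expR 1) > 264 / 1000 * lambda R G /\
  lambda R G / 2 * (1 - 1 / expR 1) > 316 / 1000 * lambda R G.
Proof.
have l0 := lambda_gt0 R G V_nonempty; have /andP[E1 E2] := invr_expR1_bounds R.
split; first exact: greedy_exists.
split=> [S gS|]; last by rewrite div1r; set E := (expR 1)^-1 in E1 E2 *; split; nra.
split.
- by case: gS => gS Sge; apply/eqP; rewrite eqn_leq (greedy_card_le gS) leqNgt.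
- apply: GH_opt_le => // [|T Tk]; first lra.
  by have [] := greedy_trunc_bound V_nonempty Tk gS.
- move=> und; rewrite -(mulrA (lambda R G)); apply: GH_opt_le => // [|T Tk].
    by rewrite div1r; lra.
  by have [_] := greedy_trunc_bound V_nonempty Tk gS; apply.
Qed.
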